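(* In the ridge regression setting described in the context, suppose that $\|\Sigma\|_{op}\le C$ and $\mathbb{E}[Z_{ij}^{12}]<C$ for all $p$, for some fixed constant $C$. Then the asymptotic predictive risk $R_P$ and the asymptotic estimation risk $R_E$ of optimally tuned ridge regression (i.e. with $\lambda^*=\gamma\alpha^{-2}$) are inversely related: $$1-\frac{1}{R_P}=\gamma\left(1-\frac{R_E}{\alpha^2}\right).$$
   Context: Ridge regression setting. Consider a sequence of problems with $n\to\infty$, $p=p(n)\to\infty$ and $p/n\to\gamma\in(0,\infty)$. For each problem, $X=Z\Sigma^{1/2}\in\mathbb{R}^{n\times p}$, where $Z$ is $n\times p$ with i.i.d. entries satisfying $\mathbb{E}[Z_{ij}]=0$, $\operatorname{Var}(Z_{ij})=1$, and $\Sigma$ is a deterministic $p\times p$ positive semidefinite matrix. The spectral distribution (c.d.f. of the eigenvalues) of $\Sigma$ converges weakly to a probability distribution $H$ supported on $[0,\infty)$. The responses are $Y=Xw+\varepsilon\in\mathbb{R}^n$, where the entries of $\varepsilon$ are independent, centered, with variance $1$, and independent of all other random quantities. The weight vector $w\in\mathbb{R}^p$ is random, independent of the features, with $\mathbb{E}[w]=0$ and $\operatorname{Var}(w)=p^{-1}\alpha^2I_{p\times p}$, where $\alpha^2>0$ is fixed. For $\lambda>0$, $\hat w_\lambda=(X^\top X+\lambda nI_{p\times p})^{-1}X^\top Y$. The predictive risk is $r_\lambda(X)=\mathbb{E}[(y-\hat w_\lambda\cdot x)^2\mid X]$, where $(x,y)$ is an independent test example from the same distribution as the training data. Stieltjes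 transforms. The spectral distribution of $\widehat\Sigma=n^{-1}X^\top X$ converges weakly almost surely to a deterministic distribution $F$ determined by $H$ and $\gamma$; let $m(z)=\int\frac{dF(l)}{l-z}$ for $z\in\mathbb{C}\setminus[0,\infty)$. The companion Stieltjes transform $v(z)$ is the Stieltjes transform of the limiting spectral distribution of $n^{-1}XX^\top$; it satisfies $\gamma(m(z)+1/z)=v(z)+1/z$. Asymptotic risks. With $\lambda^*=\gamma\alpha^{-2}$: $R_P=\frac{1}{\lambda^*v(-\lambda^* )}$ is the almost sure limit of the predictive risk of ridge regression with optimal tuning ($r_{\lambda}(X)$ with $\lambda=\lambda^*$, or $\lambda=(p/n)\alpha^{-2}$), and $R_E:=\gamma\,m(-\lambda^* )$ is the limit of the mean squared estimation error $\mathbb{E}\|\hat w_{\lambda^*}-w\|_2^2$ (taken conditionally on $X$, almost surely). *)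

(* Defs.v *)
From HB Require Import structures.
From mathcomp Require Import all_boot all_order all_algebra.
From mathcomp Require Import all_classical all_reals all_analysis.
Set Implicit Arguments.
Unset Strict Implicit.
Unset Printing Implicit Defensive.
Import Order.TTheory GRing.Theory Num.Theory.
Import numFieldNormedType.Exports.
Local Open Scope classical_set_scope.
Local Open Scope ring_scope.

Definition l2norm (R : realType) (n : nat) (u : 'cV[R]_n) : R :=
  Num.sqrt (\sum_i u i 0 ^+ 2).

Definition op_norm (R : realType) (m n : nat) (A : 'M[R]_(m, n)) : R :=
  sup [set l2norm (A *m u) | u in [set u : 'cV[R]_n | l2norm u <= 1]].

Definition psdmx (R : realType) (n : nat) (A : 'M[R]_n) : Prop :=
  A^T = A /\ forall u : 'cV[R]_n, 0 <= (u^T *m A *m u) 0 0.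

(* The unique positive semidefinite square root when A is positive
   semidefinite; the value 0 is only a default for other matrices. *)
Definition sqrtmx (R : realType) (n : nat) (A : 'M[R]_n) : 'M[R]_n :=
  xget 0 [set B : 'M[R]_n | psdmx B /\ B *m B = A].

(* The eigenvalues of A listed with multiplicity (in an arbitrary order) when
   the characteristic polynomial splits over R, in particular when A is
   symmetric. *)
Definition eigenvalues (R : realType) (n : nat) (A : 'M[R]_n) : seq R :=
  xget [::] [set s : seq R | char_poly A = \prod_(a <- s) ('X - a%:P)].

Definition spectral_cdf (R : realType) (n : nat) (A : 'M[R]_n) (t : R) : R :=
  (count (fun a => a <= t) (eigenvalues A))%:R / n%:R.

Definition cdf_of (R : realType) (mu : probability (measurableTypeR R) R)
    (t : R) : R :=
  fine (mu `]-oo, t]%classic).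

Definition weakly_converges (R : realType) (Fn : nat -> R -> R)
    (mu : probability (measurableTypeR R) R) : Prop :=
  forall t : R, {for t, continuous (cdf_of mu)} ->
    Fn n t @[n --> \oo] --> cdf_of mu t.

(* Restricted to a real argument z, outside of the support of mu. *)
Definition stieltjes (R : realType) (mu : probability (measurableTypeR R) R)
    (z : R) : R :=
  (\int[mu]_l (l - z)^-1)%R.

Section Probability.
Context {d : measure_display} {Omega : measurableType d} {R : realType}.
Implicit Type P : probability Omega R.

Definition sigma_generated (I : Type) (X : I -> Omega -> R) :
    set_system Omega :=
  <<s \bigcup_(i in [set: I]) preimage_set_system setT (X i) measurable >>.

Definition mutually_independent P (I : finType) (G : I -> set_system Omega) :
    Prop :=
  forall (J : {set I}) (A : I -> set Omega),
    (forall i, i \in J -> G i (A i)) ->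
    fine (P (\bigcap_(i in [set i | i \in J]) A i)) =
    \prod_(i in J) fine (P (A i)).

(* g is a version of the conditional expectation of f given the
   sigma-algebra G. *)
Definition is_cond_expectation P (G : set_system Omega) (f g : Omega -> R) :
    Prop :=
  [/\ P.-integrable setT (EFin \o f),
      P.-integrable setT (EFin \o g),
      forall B : set R, measurable B -> G (g @^-1` B) &
      forall A : set Omega, G A ->
        (\int[P]_(x in A) (f x)%:E = \int[P]_(x in A) (g x)%:E)%E].

(* The sequence E[f_n | G_n] converges almost surely to l. *)
Definition cond_expectation_as_limit P (G : nat -> set_system Omega)
    (f : nat -> Omega -> R) (l : R) : Prop :=
  exists g : nat -> Omega -> R,
    (forall n, is_cond_expectation P (G n) (f n) (g n)) /\
    {ae P, forall omega, g n omega @[n --> \oo] --> l}.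

End Probability.

(* One regression problem. Rows of the feature noise Z, and entries of the
   response noise eps, are indexed by [option 'I_n]: [Some i] is the i-th
   training example and [None] is the test example. *)
Record ridge_problem (d : measure_display) (Omega : measurableType d)
    (R : realType) (P : probability Omega R) (n p : nat) := RidgeProblem {
  Sigma : 'M[R]_p;
  Z : option 'I_n -> 'I_p -> {RV P >-> R};
  eps : option 'I_n -> {RV P >-> R};
  weight : 'I_p -> {RV P >-> R}
}.

Section Ridge.
Context {d : measure_display} {Omega : measurableType d} {R : realType}
  {P : probability Omega R} {n p : nat}.
Variable M : ridge_problem P n p.

Definition train_Z (omega : Omega) : 'M[R]_(n, p) :=
  \matrix_(i, j) Z M (Some i) j omega.
Definition test_z (omega : Omega) : 'rV[R]_p := \row_j Z M None j omega.
Definition w (omega : Omega) : 'cV[R]_p := \col_j weight M j omega.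
Definition train_eps (omega : Omega) : 'cV[R]_n :=
  \col_i eps M (Some i) omega.

Definition X (omega : Omega) : 'M[R]_(n, p) :=
  train_Z omega *m sqrtmx (Sigma M).
Definition Y (omega : Omega) : 'cV[R]_n :=
  X omega *m w omega + train_eps omega.

Definition test_x (omega : Omega) : 'rV[R]_p :=
  test_z omega *m sqrtmx (Sigma M).
Definition test_y (omega : Omega) : R :=
  (test_x omega *m w omega) 0 0 + eps M None omega.

Definition w_hat (lambda : R) (omega : Omega) : 'cV[R]_p :=
  invmx ((X omega)^T *m X omega + (lambda * n%:R)%:M)
    *m (X omega)^T *m Y omega.

Definition sq_prediction_error (lambda : R) (omega : Omega) : R :=
  (test_y omega - (test_x omega *m w_hat lambda omega) 0 0) ^+ 2.
Definition sq_estimation_error (lambda : R) (omega : Omega) : R :=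
  l2norm (w_hat lambda omega - w omega) ^+ 2.

Definition sigma_X : set_system Omega :=
  sigma_generated (fun (ij : 'I_n * 'I_p) omega => X omega ij.1 ij.2).

Definition Sigma_hat (omega : Omega) : 'M[R]_p :=
  n%:R^-1 *: ((X omega)^T *m X omega).
Definition companion_Sigma_hat (omega : Omega) : 'M[R]_n :=
  n%:R^-1 *: (X omega *m (X omega)^T).

(* The sigma-algebras of the entries of Z, of the entries of eps, and of the
   whole vector w; the entries of w may depend on each other. *)
Definition source_sigma
    (k : (option 'I_n * 'I_p) + option 'I_n + unit) : set_system Omega :=
  match k with
  | inl (inl (i, j)) => preimage_set_system setT (Z M i j) measurable
  | inl (inr i) => preimage_set_system setT (eps M i) measurable
  | inr tt => sigma_generated (fun j => weight M j : Omega -> R)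
  end.

Record ridge_assumptions (alpha : R) : Prop := RidgeAssumptions {
  Sigma_psd : psdmx (Sigma M);
  sources_independent : mutually_independent P source_sigma;
  Z_identically_distributed : forall i j i' j' (B : set R), measurable B ->
    distribution P (Z M i j) B = distribution P (Z M i' j') B;
  Z_mean : forall i j, 'E_P[Z M i j]%E = 0%:E;
  Z_variance : forall i j, 'V_P[Z M i j]%E = 1%:E;
  eps_mean : forall i, 'E_P[eps M i]%E = 0%:E;
  eps_variance : forall i, 'V_P[eps M i]%E = 1%:E;
  w_mean : forall j, 'E_P[weight M j]%E = 0%:E;
  w_covariance : forall j k, covariance P (weight M j) (weight M k) =
    (p%:R^-1 * alpha ^+ 2 * (j == k)%:R)%:E
}.

End Ridge.

Definition lambda_star (R : realType) (gamma alpha : R) : R :=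
  gamma / alpha ^+ 2.

(* In the next two definitions, F and F_companion stand for the limiting
   spectral distributions of X^T X / n and X X^T / n respectively. *)
Definition asymptotic_predictive_risk (R : realType) (gamma alpha : R)
    (F_companion : probability (measurableTypeR R) R) : R :=
  1 / (lambda_star gamma alpha *
       stieltjes F_companion (- lambda_star gamma alpha)).

Definition asymptotic_estimation_risk (R : realType) (gamma alpha : R)
    (F : probability (measurableTypeR R) R) : R :=
  gamma * stieltjes F (- lambda_star gamma alpha).

(* Main.v *)
Require Import Defs.
From HB Require Import structures.
From mathcomp Require Import all_boot all_order all_algebra.
From mathcomp Require Import complex spectral ring lra.
From mathcomp Require Import all_classical all_reals all_analysis.
From mathcomp Require Import measurable_realfun.
Import Order.TTheory GRing.Theory Num.Theory.
Import numFieldNormedType.Exports.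
Set Implicit Arguments.
Unset Strict Implicit.
Unset Printing Implicit Defensive.
Local Open Scope classical_set_scope.
Local Open Scope ring_scope.

(** Multiplying the companion identity [gamma (m(z) + 1/z) = v(z) + 1/z] at
    [z = - lambda] by [- lambda] gives
    [gamma (1 - lambda m(- lambda)) = 1 - lambda v(- lambda)].  Since
    [lambda = gamma / alpha^2], the left-hand side is
    [gamma (1 - R_E / alpha^2)], while [1 / R_P = lambda v(- lambda)]: this is
    the inverse relation.

    The companion identity is the limit of an exact statement about each
    matrix [X] of size [n] by [p].  The matrices [X^T X] and [X X^T] have the
    same spectrum up to zeros ([perm_eigenvalues_gram]), so that the fractions
    of eigenvalues above a threshold [t] (or, when [t < 0], minus the fractions
    at or below it) differ exactly by the factor [p / n] ([spectral_cdf_gram]).  On a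
    realization of [X] for which both spectral distributions converge, the
    factor tends to [gamma] and the relation passes to the limits [F] and
    [F_companion] ([companion_cdf_limit]), first at the common continuity points
    of their distribution functions and then everywhere by right-continuity.
    It says that the measures [F_companion + gamma d_0] and [gamma F + d_0],
    where [d_0] is the Dirac mass at 0, agree on all rays [(-oo, t]], hence are
    equal; integrating [1 / (l - z)] against both gives the companion
    identity ([companion_stieltjes]).  Both limits live on [[0, +oo)], where the
    integrand is bounded, because the matrices are positive semidefinite
    ([weak_limit_support]). *)

(** * Spectra of Gram matrices *)

Lemma char_poly_conj (F : comUnitRingType) (n : nat) (P A : 'M[F]_n) :
  P \in unitmx -> char_poly (invmx P *m A *m P) = char_poly A.
Proof.
move=> Pu; pose Q := map_mx (@polyC F) P.
pose Q' := map_mx (@polyC F) (invmx P).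
have QQ : Q' *m Q = 1%:M by rewrite -map_mxM mulVmx ?map_mx1.
have -> : char_poly (invmx P *m A *m P) = \det (Q' *m char_poly_mx A *m Q).
  rewrite /char_poly /char_poly_mx mulmxBr mulmxBl !map_mxM.
  by rewrite scalar_mxC -[_ *m Q' *m Q]mulmxA QQ mulmx1.
by rewrite !det_mulmx mulrAC -det_mulmx QQ det1 mul1r.
Qed.

(** Over [R[i]] the matrix is Hermitian, hence conjugate to a diagonal matrix
    with real entries, which splits the characteristic polynomial over [R]. *)
Lemma symmetric_char_poly_splits (R : rcfType) (n : nat) (A : 'M[R]_n) :
  A^T = A -> exists s : seq R, char_poly A = \prod_(a <- s) ('X - a%:P).
Proof.
move=> Asym; pose B := map_mx (real_complex R) A.
have Breal : B \is a mxOver Num.real.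
  by apply/mxOverP => i j; rewrite mxE complex_real.
have Bsym : B \is symmetricmx.
  by apply/is_hermitianmxP; rewrite expr0 scale1r map_mx_id// map_trmx Asym.
have Bherm := realsym_hermsym Bsym Breal.
have /mxOverP dreal := hermitian_spectral_diag_real Bherm.
exists [seq complex.Re (spectral_diag B 0 i) | i : 'I_n].
apply: (map_inj_poly (@complexI R)) => //.
rewrite map_char_poly -/B.
have /hermitian_normalmx/orthomx_spectralP {1}-> := Bherm.
rewrite char_poly_conj ?spectral_unit// char_poly_trig ?diag_mx_is_trig//.
rewrite big_map big_enum rmorph_prod; apply: eq_bigr => i _.
by rewrite rmorphB /= map_polyX map_polyC/= mxE eqxx mulr1n RRe_real.
Qed.

(** The block matrices [M] and [N] below are chosen so that both [M N] and [N M]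
    are block triangular, with the two sides as determinants. *)
Lemma char_poly_mulmxC (F : comNzRingType) (m n : nat) (A : 'M[F]_(m, n))
    (B : 'M[F]_(n, m)) :
  'X^n * char_poly (A *m B) = 'X^m * char_poly (B *m A).
Proof.
pose a := map_mx (@polyC F) A; pose b := map_mx (@polyC F) B.
pose M := block_mx ('X%:M : 'M[{poly F}]_m) a b (1%:M : 'M[{poly F}]_n).
pose N := block_mx (1%:M : 'M[{poly F}]_m) 0 (- b) ('X%:M : 'M[{poly F}]_n).
have MN : M *m N = block_mx (char_poly_mx (A *m B)) ('X *: a) 0 'X%:M.
  rewrite mulmx_block !mulmx1 !mul1mx !mulmx0 add0r mulmxN subrr.
  by rewrite mul_mx_scalar /char_poly_mx map_mxM add0r.
have NM : N *m M = block_mx 'X%:M a 0 (char_poly_mx (B *m A)).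
  rewrite mulmx_block !mul1mx !mul0mx !addr0 mulmx1 !mulNmx mul_mx_scalar.
  by rewrite mul_scalar_mx /char_poly_mx map_mxM addNr [in RHS]addrC.
have : \det (M *m N) = \det (N *m M) by rewrite !det_mulmx mulrC.
by rewrite NM MN !det_ublock !det_scalar mulrC.
Qed.

Lemma psdmx_gram (R : realType) (m n : nat) (c : R) (A : 'M[R]_(m, n)) :
  0 <= c -> psdmx (c *: (A^T *m A)).
Proof.
move=> c0; split=> [|u]; first by rewrite linearZ/= trmx_mul trmxK.
rewrite -scalemxAr -scalemxAl mxE mulr_ge0// mulmxA -trmx_mul -mulmxA mxE.
by apply: sumr_ge0 => i _; rewrite mxE -expr2 sqr_ge0.
Qed.

(** Symmetric matrices never fall under the default case of [eigenvalues]. *)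
Lemma eigenvaluesE (R : realType) (n : nat) (A : 'M[R]_n) :
  A^T = A -> char_poly A = \prod_(a <- eigenvalues A) ('X - a%:P).
Proof.
move=> /symmetric_char_poly_splits exs.
exact: (@xgetPex _ [::] [set s | char_poly A = \prod_(a <- s) ('X - a%:P)]).
Qed.

(** On an eigenvector, the quadratic form is the eigenvalue times a squared
    norm. *)
Lemma psdmx_eigenvalues_ge0 (R : realType) (n : nat) (A : 'M[R]_n) (a : R) :
  psdmx A -> a \in eigenvalues A -> 0 <= a.
Proof.
move=> [Asym Apsd] aA.
have : root (char_poly A) a by rewrite eigenvaluesE// root_prod_XsubC.
rewrite -eigenvalue_root_char => /eigenvalueP[v vA v0].
have := Apsd v^T; rewrite trmxK vA -scalemxAl mxE.
suff vv : 0 < (v *m v^T) 0 0 by rewrite pmulr_lge0.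
rewrite mxE lt_def; apply/andP; split; last first.
  by apply: sumr_ge0 => i _; rewrite mxE -expr2 sqr_ge0.
apply: contra v0; rewrite psumr_eq0 => [/allP s0|i _]; last first.
  by rewrite mxE -expr2 sqr_ge0.
apply/eqP/rowP => i; rewrite [RHS]mxE; apply/eqP.
by have := s0 i (mem_index_enum _); rewrite mxE -expr2 sqrf_eq0.
Qed.

Lemma psdmx_spectral_cdf_lt0 (R : realType) (n : nat) (A : 'M[R]_n) (t : R) :
  psdmx A -> t < 0 -> spectral_cdf A t = 0.
Proof.
move=> Apsd t0; rewrite /spectral_cdf.
suff -> : count (fun a => a <= t) (eigenvalues A) = 0%N by rewrite mul0r.
apply/eqP; rewrite -leqn0 leqNgt -has_count; apply/hasPn => a aA.
by rewrite -ltNge (lt_le_trans t0)// (psdmx_eigenvalues_ge0 Apsd).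
Qed.

(** This is [char_poly_mulmxC] read on linear factors: the powers of [X] become
    zero eigenvalues. *)
Lemma perm_eigenvalues_gram (R : realType) (m n : nat) (c : R)
    (A : 'M[R]_(m, n)) :
  perm_eq (nseq n 0 ++ eigenvalues (c *: (A *m A^T)))
          (nseq m 0 ++ eigenvalues (c *: (A^T *m A))).
Proof.
apply: prod_XsubC_eq.
have Xn k : \prod_(a <- nseq k 0) ('X - a%:P) = 'X^k :> {poly R}.
  by rewrite big_nseq subr0 -Monoid.iteropE.
rewrite !big_cat/= !Xn -!eigenvaluesE ?linearZ/= ?trmx_mul ?trmxK//.
by rewrite scalemxAl char_poly_mulmxC scalemxAr.
Qed.

(** Comparing with the distribution function of the Dirac mass at 0 discards the
    zero eigenvalues, the only ones in which the two spectra differ; the ratio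
    [n / m] accounts for the normalizations. *)
Lemma spectral_cdf_gram (R : realType) (m n : nat) (c : R) (A : 'M[R]_(m, n))
    (t : R) : (0 < m)%N -> (0 < n)%N ->
  n%:R / m%:R * ((0 <= t)%R%:R - spectral_cdf (c *: (A^T *m A)) t) =
  (0 <= t)%R%:R - spectral_cdf (c *: (A *m A^T)) t.
Proof.
move=> m0 n0.
have /permP/(_ (fun a : R => a <= t)) := perm_eigenvalues_gram c A.
rewrite !count_cat !count_nseq /spectral_cdf.
move/(congr1 (fun k => k%:R : R)); rewrite !natrD !natrM => E.
have mR : m%:R != 0 :> R by rewrite pnatr_eq0 -lt0n.
have nR : n%:R != 0 :> R by rewrite pnatr_eq0 -lt0n.
have {}E := canRL (addrK _) (etrans (addrC _ _) (esym E)).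
rewrite E; field; exact/andP.
Qed.

(** * Distribution functions and weak limits *)

(** [cdf] speaks of random variables: [idTR] is one whose law is [mu]. *)
Section cdf.
Context {R : realType} (mu : probability (measurableTypeR R) R).

Let idTR : measurableTypeR R -> R := idfun.
#[local] HB.instance Definition _ :=
  @isMeasurableFun.Build _ _ _ _ idTR (@measurable_id _ _ setT).

Lemma cdf_of_right_continuous : right_continuous (cdf_of mu).
Proof.
move=> a; apply: fine_cvg.
rewrite fineK ?fin_num_measure//.
exact: (@cdf_right_continuous _ _ _ mu (idTR : {RV mu >-> R}) a).
Qed.

End cdf.

Lemma cdf_of_nondecreasing (R : realType)
    (mu : probability (measurableTypeR R) R) :
  nondecreasing (cdf_of mu).
Proof.
move=> a b ab; rewrite fine_le ?fin_num_measure// le_measure ?inE//.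
exact: subitvPr.
Qed.

(** Right-continuity turns a discontinuity of a monotone function into a jump,
    and there are countably many jumps. *)
Lemma countable_discontinuities (R : realType) (f : R -> R) (a b : R) :
  nondecreasing f -> right_continuous f ->
  countable [set x | x \in (`]a, b[) /\ ~ {for x, continuous f}].
Proof.
move=> fnd frc; apply: sub_countable (@discontinuity_countable R a b f _).
  2: by move=> x y _ _; exact: fnd.
apply: subset_card_le => x [xab ncf]; split=> //.
have fl : cvg (f y @[y --> x^'-]).
  apply: nondecreasing_at_left_is_cvgr.
    by near=> z => y1 y2 _ _; exact: fnd.
  near=> z; exists (f x) => _ [y yx <-]; apply/fnd/ltW.
  by move: yx; rewrite /= in_itv/= => /andP[].
split=> //; first by apply/cvg_ex; exists (f x); exact: frc.
apply/negP => /eqP E; apply: ncf; apply/left_right_continuousP.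
split; last exact: frc.
by rewrite -(cvg_lim _ (frc x))// -E.
Unshelve. all: by end_near. Qed.

(** Countable sets are Lebesgue null, and nonempty open intervals are not. *)
Lemma exists_common_continuity_point (R : realType) (f g : R -> R) (a b : R) :
  nondecreasing f -> right_continuous f ->
  nondecreasing g -> right_continuous g -> a < b ->
  exists t, [/\ a < t, t < b, {for t, continuous f} & {for t, continuous g}].
Proof.
move=> fnd frc gnd grc ab; apply: contrapT => none.
pose D (h : R -> R) := [set x | x \in (`]a, b[) /\ ~ {for x, continuous h}].
have D0 (h : R -> R) : nondecreasing h -> right_continuous h ->
    measurable (D h) /\ lebesgue_measure (D h) = 0.
  move=> hnd hrc; have cD := countable_discontinuities a b hnd hrc.
  by split; [exact: countable_measurable|exact: countable_lebesgue_measure0].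
have [[mf f0] [mg g0]] := (D0 f fnd frc, D0 g gnd grc).
have : (lebesgue_measure `]a, b[%classic <= lebesgue_measure (D f `|` D g))%E.
  rewrite le_measure ?inE//; first exact: measurableU.
  move=> t /= tab; have /andP[at_ tb] : a < t < b by move: tab; rewrite in_itv.
  have [cf|ncf] := pselect {for t, continuous f}; last by left.
  by right; split=> // cg; apply: none; exists t.
rewrite lebesgue_measure_itv/= lte_fin ab.
rewrite (etrans (@measureU0 _ _ _ (@lebesgue_measure R) _ _ mf mg g0) f0).
by rewrite -EFinB lee_fin subr_le0 leNgt ab.
Qed.

(** Any point [a] is the limit of a sequence of agreement points lying strictly
    to its right. *)
Lemma eq_right_continuous (R : realType) (f g : R -> R) :
  right_continuous f -> right_continuous g ->
  (forall a b, a < b -> exists t, [/\ a < t, t < b & f t = g t]) -> f = g.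
Proof.
move=> frc grc dense; apply/funext => a.
have /choice[u uP] : forall n : nat, exists t,
    [/\ a < t, t < a + n.+1%:R^-1 & f t = g t].
  by move=> n; apply: dense; rewrite ltrDl.
have ua : u n @[n --> \oo] --> a.
  apply: (@squeeze_cvgr _ _ _ _ (cst a) (fun n => a + n.+1%:R^-1)).
  - by near=> n; have [/ltW-> /ltW-> _] := uP n.
  - exact: cvg_cst.
  - rewrite -[X in _ --> X]addr0; apply: cvgD; first exact: cvg_cst.
    exact: cvg_harmonic.
have au n : a < u n by have [] := uP n.
have fu := (cvg_at_rightP f a (f a)).1 (frc a) u (conj au ua).
have gu := (cvg_at_rightP g a (g a)).1 (grc a) u (conj au ua).
have fgu : (fun n => f (u n)) = (fun n => g (u n)).
  by apply/funext => n; have [_ _ ->] := uP n.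
by rewrite fgu in fu; exact: (cvg_unique _ fu gu).
Unshelve. all: by end_near. Qed.

(** Differences of rays give the half-open intervals, a generating family stable
    under intersection that exhausts the line. *)
Lemma measure_eq_of_rays (R : realType)
    (m1 m2 : {measure set (measurableTypeR R) -> \bar R}) :
  (forall t, m1 `]-oo, t]%classic = m2 `]-oo, t]%classic) ->
  (forall t, (m1 `]-oo, t]%classic < +oo)%E) ->
  forall A, measurable A -> m1 A = m2 A.
Proof.
move=> m12 m1fin.
have split_ray (a b : R) : `]a, b]%classic = `]-oo, b] `\` `]-oo, a].
  by rewrite -[RHS]setCK setCD setCitvl setUC -[LHS]setCK setCitv.
have m12_itv (a b : R) : m1 `]a, b]%classic = m2 `]a, b]%classic.
  have [ba|ab] := leP b a.
    by rewrite set_itv_ge ?measure0// bnd_simp -leNgt.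
  rewrite split_ray !measureD//= -?m12//.
  rewrite setIidr -?m12//; apply: subset_itvl; exact: ltW.
apply: (@measure_unique _ R (measurableTypeR R) (@ocitv R)
  (fun k : nat => `](- k%:R), k%:R]%classic)).
- by [].
- exact: ocitvI.
- by move=> i; exact: is_ocitv.
- exact: bigcup_itvT.
- by move=> _ [[a b] _ <-]; exact: m12_itv.
- move=> k; apply: le_lt_trans (m1fin k%:R); rewrite le_measure ?inE//.
  by move=> x /=; rewrite !in_itv/= => /andP[].
Qed.

(** The point 0 may be an atom of the limit, so that the mass of the open ray is
    recovered from the closed rays ending at negative points, which are null. *)
Lemma weak_limit_support (R : realType) (Fn : nat -> R -> R)
    (mu : probability (measurableTypeR R) R) :
  (forall n t, t < 0 -> Fn n t = 0) -> weakly_converges Fn mu ->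
  mu `]-oo, 0[%classic = 0%E.
Proof.
move=> Fn0 Fnmu.
have cdf0 t : t < 0 -> mu `]-oo, t]%classic = 0%E.
  move=> t0; have nd := cdf_of_nondecreasing mu.
  have rc := @cdf_of_right_continuous R mu.
  have [s [ts s0 sc _]] := exists_common_continuity_point nd rc nd rc t0.
  have : cdf_of mu s = 0.
    have Fns : (fun n => Fn n s) = (fun=> 0) by apply/funext => n; exact: Fn0.
    have := Fnmu s sc; rewrite Fns => cv0.
    exact: (cvg_unique _ cv0 (cvg_cst _)).
  have /= := nd _ _ (ltW ts) => ts' s0'.
  apply/eqP; rewrite -(@fineK _ (mu _)) ?fin_num_measure// eqe eq_le fine_ge0//.
  by rewrite andbT -s0'.
apply: measure_negligible => //.
have : mu.-negligible (\bigcup_n `]-oo, - n.+1%:R^-1]%classic).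
  apply: negligible_bigcup => n; apply/negligibleP => //.
  by apply: cdf0; rewrite oppr_lt0.
apply: negligibleS => t /=; rewrite in_itv/= => t0.
have [n nt] := ltr_add_invr t0.
by exists n => //=; rewrite in_itv/= lerNr -subr_le0 opprK addrC ltW.
Qed.

Lemma integral_supported (R : realType)
    (mu : probability (measurableTypeR R) R) (k : measurableTypeR R -> \bar R) :
  mu `]-oo, 0[%classic = 0%E -> measurable_fun setT k ->
  (\int[mu]_l k l = \int[mu]_(l in `[0%R, +oo[) k l)%E.
Proof.
move=> mu0 mk; rewrite [RHS]integral_mkcond; apply: ae_eq_integral => //.
  by apply/(measurable_restrictT _ _).1 => //; exact: measurable_funS mk.
exists `]-oo, 0[%classic; split => // l /=.
rewrite in_itv/= ltNge; apply: contra_notN => l0 _.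
by rewrite patchE mem_set//= in_itv/= l0.
Qed.

Lemma measurable_inv (R : realType) :
  measurable_fun setT (fun x : measurableTypeR R => x^-1).
Proof.
rewrite -(setvU [set 0 : R]) setUC; apply/measurable_funU => //.
  exact: measurableC.
split; first exact: measurable_fun_set1.
apply: open_continuous_measurable_fun; first exact: closed_openC.
by move=> x; rewrite inE => /eqP x0; exact: inv_continuous.
Qed.

(** The integrand is bounded by [1 / (- z)] on the half-line, so that the
    extended integral is finite and [stieltjes], a truncation to the reals,
    loses nothing. *)
Lemma stieltjes_supported (R : realType)
    (mu : probability (measurableTypeR R) R) (z : R) :
  mu `]-oo, 0[%classic = 0%E -> z < 0 ->
  (\int[mu]_(l in `[0%R, +oo[) ((l - z)^-1)%:E)%E = (stieltjes mu z)%:E.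
Proof.
move=> mu0 z0; have mk : measurable_fun setT
    (fun l : measurableTypeR R => ((l - z)^-1)%:E).
  apply/measurable_EFinP; apply: measurableT_comp; first exact: measurable_inv.
  exact: measurable_funB.
rewrite /stieltjes /Rintegral integral_supported// fineK//.
have kb (l : R) : `[0%R, +oo[%classic l -> 0 <= (l - z)^-1 <= (- z)^-1.
  rewrite /= in_itv/= andbT => l0.
  have z0' : 0 < - z by rewrite oppr_gt0.
  have lz : 0 < l - z by rewrite ltr_wpDl.
  by rewrite invr_ge0 ltW//= lef_pV2 ?posrE// lerDr.
rewrite ge0_fin_numE; last first.
  by apply: integral_ge0 => l /kb; rewrite lee_fin => /andP[].
apply: (@le_lt_trans _ _ (\int[mu]_(l in `[0%R, +oo[) (cst (- z)^-1%:E l))%E).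
  apply: ge0_le_integral => //.
  - by move=> l /kb/andP[]; rewrite lee_fin.
  - exact: measurable_funS mk.
  - by move=> l /kb/andP[_]; rewrite lee_fin.
rewrite integral_cst// -ge0_fin_numE.
  by rewrite fin_numM// fin_num_measure.
by rewrite mule_ge0// lee_fin invr_ge0 oppr_ge0 ltW.
Qed.

Lemma cdf_of_dirac0 (R : realType) (t : R) :
  cdf_of (\d_(0 : measurableTypeR R) : probability _ R) t = (0 <= t)%R%:R.
Proof. by rewrite /cdf_of /= /dirac indicE mem_setE in_itv. Qed.

(** The relation between the distribution functions is an equality of rays for
    the positive measures [G + gamma d0] and [gamma F + d0].  Moving the Dirac
    masses to opposite sides avoids signed measures and a case distinction on
    [gamma <= 1]; [d0] contributes [1 / (0 - z)] to the integral. *)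
Lemma companion_stieltjes (R : realType) (gamma z : R)
    (F G : probability (measurableTypeR R) R) :
  0 <= gamma -> z < 0 ->
  F `]-oo, 0[%classic = 0%E -> G `]-oo, 0[%classic = 0%E ->
  (forall t,
    gamma * ((0 <= t)%R%:R - cdf_of F t) = (0 <= t)%R%:R - cdf_of G t) ->
  gamma * (stieltjes F z + z^-1) = stieltjes G z + z^-1.
Proof.
move=> g0 z0 F0 G0 FG; pose g : {nonneg R} := NngNum g0.
pose d0 : probability (measurableTypeR R) R := \d_(0 : measurableTypeR R).
pose m1 : {measure set (measurableTypeR R) -> \bar R} :=
  measure_add G (mscale g d0).
pose m2 : {measure set (measurableTypeR R) -> \bar R} :=
  measure_add (mscale g F) d0.
have rayE (mu : probability (measurableTypeR R) R) t :
    mu `]-oo, t]%classic = (cdf_of mu t)%:E.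
  by rewrite fineK// fin_num_measure.
have d0E t : d0 `]-oo, t]%classic = ((0 <= t)%R%:R)%:E.
  by rewrite rayE cdf_of_dirac0.
have m1E t : m1 `]-oo, t]%classic = (cdf_of G t + gamma * (0 <= t)%R%:R)%:E.
  rewrite [LHS]measure_addE.
  exact: (f_equal2 (fun x y : \bar R => (x + gamma%:E * y)%E)
    (rayE G t) (d0E t)).
have m2E t : m2 `]-oo, t]%classic = (gamma * cdf_of F t + (0 <= t)%R%:R)%:E.
  rewrite [LHS]measure_addE.
  exact: (f_equal2 (fun x y : \bar R => (gamma%:E * x + y)%E)
    (rayE F t) (d0E t)).
have m12 : forall A, measurable A -> m1 A = m2 A.
  apply: measure_eq_of_rays => t; last by rewrite m1E ltry.
  by rewrite m1E m2E; congr EFin; have := FG t; lra.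
have mk : measurable_fun (`[0%R, +oo[%classic : set (measurableTypeR R))
    (fun l : measurableTypeR R => ((l - z)^-1)%:E).
  apply/measurable_EFinP; apply: measurableT_comp; first exact: measurable_inv.
  exact: measurable_funB.
have k0 (l : R) : `[0%R, +oo[%classic l -> (0 <= ((l - z)^-1)%:E)%E.
  rewrite /= in_itv/= andbT lee_fin invr_ge0 subr_ge0 => l0.
  exact: le_trans (ltW z0) l0.
have kd0 : (\int[d0]_(l in `[0%R, +oo[) ((l - z)^-1)%:E)%E = (- z^-1)%:E.
  rewrite /d0 integral_dirac// diracE mem_setE in_itv/= lexx mul1e.
  by rewrite sub0r invrN.
have : (\int[m1]_(l in `[0%R, +oo[) ((l - z)^-1)%:E =
        \int[m2]_(l in `[0%R, +oo[) ((l - z)^-1)%:E)%E.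
  by apply: eq_measure_integral => A mA _; exact: m12.
rewrite !ge0_integral_measure_add// !ge0_integral_mscale// kd0.
rewrite !stieltjes_supported// -!EFinM -!EFinD => -[]; rewrite /=; lra.
Qed.

(** Weak convergence gives the limits only at continuity points of [cdf_of F]
    and [cdf_of G].  The common ones are dense, and both sides of the conclusion are
    right-continuous, the indicator being itself the distribution function of a
    Dirac mass. *)
Lemma companion_cdf_limit (R : realType) (r : nat -> R) (gamma : R)
    (Fn Gn : nat -> R -> R) (F G : probability (measurableTypeR R) R) :
  r n @[n --> \oo] --> gamma ->
  (\forall n \near \oo, forall t,
    r n * ((0 <= t)%R%:R - Fn n t) = (0 <= t)%R%:R - Gn n t) ->
  weakly_converges Fn F -> weakly_converges Gn G ->
  forall t, gamma * ((0 <= t)%R%:R - cdf_of F t) = (0 <= t)%R%:R - cdf_of G t.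
Proof.
move=> rg FGn FnF GnG.
pose e := cdf_of (\d_(0 : measurableTypeR R) : probability _ R).
have eE t : (0 <= t)%R%:R = e t by rewrite /e cdf_of_dirac0.
pose f t := gamma * (e t - cdf_of F t); pose h t := e t - cdf_of G t.
suff fh : f = h by move=> t; rewrite eE -[LHS]/(f t) fh.
have rc := @cdf_of_right_continuous R.
apply: eq_right_continuous => [t|t|a b ab].
- by apply: cvgM; [exact: cvg_cst|apply: cvgB; exact: rc].
- by apply: cvgB; exact: rc.
have [t [at_ tb cF cG]] := exists_common_continuity_point
  (cdf_of_nondecreasing F) (@rc F) (cdf_of_nondecreasing G) (@rc G) ab.
exists t; split=> //.
have lf : r n * (e t - Fn n t) @[n --> \oo] --> f t.
  by apply: cvgM => //; apply: cvgB; [exact: cvg_cst|exact: FnF].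
have lh : e t - Gn n t @[n --> \oo] --> h t.
  by apply: cvgB; [exact: cvg_cst|exact: GnG].
have lfh : r n * (e t - Fn n t) @[n --> \oo] --> h t.
  apply: cvg_trans lh; apply: near_eq_cvg.
  by apply: filterS FGn => n /(_ t); rewrite eE => ->.
exact: (cvg_unique _ lf lfh).
Qed.

(** * The inverse relation *)

Theorem corollary2p2
  (R : realType) (d : measure_display) (Omega : measurableType d)
  (P : probability Omega R)
  (p : nat -> nat) (gamma alpha C : R)
  (M : forall n : nat, ridge_problem P n (p n))
  (H F F_companion : probability (measurableTypeR R) R)
  (p_infty : p n @[n --> \oo] --> \oo)
  (aspect_ratio : (p n)%:R / n%:R @[n --> \oo] --> gamma)
  (gamma_gt0 : 0 < gamma)
  (alpha2_gt0 : 0 < alpha ^+ 2)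
  (ridge_setting : forall n, ridge_assumptions (M n) alpha)
  (H_support : H `[0, +oo[%classic = 1%:E)
  (H_limit : weakly_converges (fun n => spectral_cdf (Sigma (M n))) H)
  (Sigma_bounded : forall n, op_norm (Sigma (M n)) <= C)
  (Z_moment12 : forall n i j,
    ('E_P[(fun omega => Z (M n) i j omega ^+ 12)%R] < C%:E)%E)
  (F_limit : {ae P, forall omega,
    weakly_converges (fun n => spectral_cdf (Sigma_hat (M n) omega)) F})
  (F_companion_limit : {ae P, forall omega,
    weakly_converges (fun n => spectral_cdf (companion_Sigma_hat (M n) omega))
      F_companion}) :
  let lambda := lambda_star gamma alpha in
  let R_P := asymptotic_predictive_risk gamma alpha F_companion in
  let R_E := asymptotic_estimation_risk gamma alpha F in
  cond_expectation_as_limit P (fun n => sigma_X (M n))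
    (fun n => sq_prediction_error (M n) lambda) R_P ->
  cond_expectation_as_limit P (fun n => sigma_X (M n))
    (fun n => sq_estimation_error (M n) lambda) R_E ->
  1 - 1 / R_P = gamma * (1 - R_E / alpha ^+ 2).
Proof.
move=> lambda R_P R_E _ _.
have lambda0 : 0 < lambda by exact: divr_gt0.
have Sigma_hat_psd n omega : psdmx (Sigma_hat (M n) omega).
  by apply: psdmx_gram; rewrite invr_ge0.
have companion_psd n omega : psdmx (companion_Sigma_hat (M n) omega).
  rewrite /companion_Sigma_hat -[X in X *m _]trmxK.
  by apply: psdmx_gram; rewrite invr_ge0.
have P_proper : ProperFilter (almost_everywhere P).
  have : (0 < P setT)%E by rewrite probability_setT lte01.
  exact: ae_properfilter_algebraOfSetsType.
(* From here on a single realization of the features is enough. *)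
have [omega [Flim Glim]] := filter_ex (filterI F_limit F_companion_limit).
have FG : forall t, gamma * ((0 <= t)%R%:R - cdf_of F t) =
    (0 <= t)%R%:R - cdf_of F_companion t.
  apply: (companion_cdf_limit aspect_ratio _ Flim Glim).
  near=> n => t; apply: spectral_cdf_gram.
    by near: n; exact: nbhs_infty_gt.
  by near: n; exact: (p_infty _ (nbhs_infty_gt 0)).
have F0 : F `]-oo, 0[%classic = 0%E.
  apply: weak_limit_support Flim => n t; exact: psdmx_spectral_cdf_lt0.
have G0 : F_companion `]-oo, 0[%classic = 0%E.
  apply: weak_limit_support Glim => n t; exact: psdmx_spectral_cdf_lt0.
have Nlambda0 : - lambda < 0 by rewrite oppr_lt0.
have := companion_stieltjes (ltW gamma_gt0) Nlambda0 F0 G0 FG.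
rewrite /R_P /R_E /asymptotic_predictive_risk /asymptotic_estimation_risk.
rewrite -/lambda !div1r invrK invrN.
set m := stieltjes F _; set v := stieltjes F_companion _ => mv.
have -> : gamma * m / alpha ^+ 2 = lambda * m by rewrite mulrAC.
have lambdaV : lambda * lambda^-1 = 1 by rewrite divff// gt_eqF.
have := congr1 ( *%R lambda) mv; rewrite mulrCA !mulrDr !mulrN lambdaV.
lra.
Unshelve. all: by end_near. Qed.
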